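(* Let $s,t,u$ be three different operators on the space of entire functions on $\mathbb{C}^n$ (maps from this space to itself). Let $f,\eta,\eta_1,\dots,\eta_6$ be entire functions on $\mathbb{C}^n$, where $\eta$ is irreducible, and suppose $\xi_0=\eta_1\eta_4-\eta_2\eta_3\not\equiv 0$. Then $f$ is a solution of $$\left(\eta_1s(f)+\eta_2t(f)+\eta_5u(f)\right)^2+\left(\eta_3s(f)+\eta_4t(f)+\eta_6u(f)\right)^2=\eta$$ if and only if there exist $k\in\{1,-1\}$ and an entire function $g$ such that $$\begin{pmatrix} s(f)\\ t(f)\end{pmatrix}=\frac{1}{2i\xi_0}\begin{pmatrix}-\zeta_1&\eta\zeta_2\\ \tau_1&-\eta\tau_2\end{pmatrix}\begin{pmatrix}e^{ig}\\ e^{-ig}\end{pmatrix}+\frac{1}{\xi_0}\begin{pmatrix}\xi_1\\ \xi_2\end{pmatrix}u(f),\qquad( * )$$ where $$\tau_1=k\eta_1-i\eta_3,\quad \tau_2=k\eta_1+i\eta_3,\quad \zeta_1=k\eta_2-i\eta_4,\quad \zeta_2=k\eta_2+i\eta_4,$$ $$\xi_1=\eta_2\eta_6-\eta_4\eta_5,\quad \xi_2=\eta_3\eta_5-\eta_1\eta_6 .$$ Further, if $g_*$ is another entire function for which $f$ satisfies $( * )$ with $g$ replaced by $g_*$ (for some, possibly different, $k\in\{1,-1\}$), then either $g+g_*$ or $g-g_*$ is constant.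
   Context: ''Irreducible'' refers to the ring of entire functions on $\mathbb{C}^n$: $\eta$ is either a non-zero constant, or a non-zero, non-unit element such that in every factorization $\eta=vw$ into entire functions one of $v,w$ has no zeros. The identity $( * )$ is an identity of meromorphic functions. *)

(* Defs.v *)
From HB Require Import structures.
From mathcomp Require Import all_boot all_order all_algebra complex.
From mathcomp Require Import all_classical all_reals all_analysis.
Import numFieldNormedType.Exports.

Set Implicit Arguments.
Unset Strict Implicit.
Unset Printing Implicit Defensive.

Import Order.TTheory GRing.Theory Num.Theory.
Local Open Scope ring_scope.
Local Open Scope complex_scope.

(* MathComp-Analysis equips every abstract numFieldType with its standard norm
   and topology; these instances do the same for the concrete field R[i]. *)
#[export, non_forgetful_inheritance]
HB.instance Definition _ (R : rcfType) := GRing.ComAlgebra.copy R[i] R[i]^o.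
#[export, non_forgetful_inheritance]
HB.instance Definition _ (R : rcfType) := Vector.copy R[i] R[i]^o.
#[export, non_forgetful_inheritance]
HB.instance Definition _ (R : rcfType) := NormedModule.copy R[i] R[i]^o.

(* Both sides are normed modules over R[i], so the differential is R[i]-linear:
   this is complex differentiability at every point of C^n. *)
Definition is_entire (R : realType) (n : nat) (f : 'rV[R[i]]_n -> R[i]) : Prop :=
  forall z : 'rV[R[i]]_n, differentiable f z.

Record entire (R : realType) (n : nat) := Entire {
  entire_fun :> 'rV[R[i]]_n -> R[i];
  entire_funP : is_entire entire_fun
}.

Definition cexp (R : realType) (z : R[i]) : R[i] :=
  (expR (complex.Re z))%:C * (cos (complex.Im z) +i* sin (complex.Im z)).

Definition is_const (R : realType) (n : nat) (h : 'rV[R[i]]_n -> R[i]) : Prop :=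
  exists c : R[i], forall z, h z = c.

Definition not_identically_zero (R : realType) (n : nat)
    (h : 'rV[R[i]]_n -> R[i]) : Prop :=
  exists z, h z != 0.

Definition has_no_zeros (R : realType) (n : nat)
    (h : 'rV[R[i]]_n -> R[i]) : Prop :=
  forall z, h z != 0.

Definition entire_unit (R : realType) (n : nat) (v : entire R n) : Prop :=
  exists w : entire R n, forall z, v z * w z = 1.

(* By convention non-zero constants are irreducible; other units are not. *)
Definition entire_irreducible (R : realType) (n : nat) (h : entire R n) : Prop :=
  (is_const h /\ not_identically_zero h) \/
  [/\ not_identically_zero h,
      ~ entire_unit h
    & forall v w : entire R n, (forall z, h z = v z * w z) ->
        has_no_zeros v \/ has_no_zeros w].

(* Main.v *)
(** With [A], [B] the two inner expressions, [star k g] is, by linear algebra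
    where [xi0 <> 0], the pair [A + i k B = e^(ig)], [A - i k B = eta e^(-ig)].
    If [A^2 + B^2 = (A + iB)(A - iB) = eta] with [eta] irreducible, one of the
    two factors has no zeros, hence has an entire logarithm.  The converse and
    the uniqueness of [g] hold first where [xi0 <> 0] and then everywhere by
    the identity theorem.

    Entire means complex differentiable only, so the identity theorem needs
    Goursat.  Left-endpoint Riemann sums around a parallelogram vanish exactly
    on affine functions, so bisection makes them tend to 0 for differentiable
    ones; in exponential coordinates this yields [|F p| <= sup |F|] over any
    circle centred at [p].  If [F = 0] near [c] and [r = |p - c|], applying this
    to [F / (z - c)^N] on the circle of radius [3 r] gives
    [|F p| <= 2^(-N) M] for all [N].

    The logarithm is a continuous lift along rays: a sum of principal logarithms
    of quotients at consecutive points of a subdivision of [[0, z]], independent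
    of the subdivision, and differentiable because [exp] has a local inverse. *)

Require Import Defs.
From mathcomp Require Import all_boot all_order all_algebra complex.
From mathcomp Require Import all_classical all_reals all_analysis.
From mathcomp Require Import ring lra.
Import GRing.Theory Num.Theory.
Import Order.TTheory numFieldNormedType.Exports.
Local Open Scope classical_set_scope.
Local Open Scope ring_scope.
Local Open Scope complex_scope.

Set Implicit Arguments.
Unset Strict Implicit.
Unset Printing Implicit Defensive.

(** * Real-valued modulus and one-variable complex differentiability *)

Section ComplexModulus.
Variable R : realType.
Implicit Types (x y : R[i]) (F : R[i] -> R[i]).

(** The norm on [R[i]] takes its values in [R[i]]; this is the same number in [R], where the order
    is total. *)
Definition cmod x : R := Normc.normc x.

Lemma cmodE x : `|x| = (cmod x)%:C.
Proof. by rewrite normc_def /cmod; case: x. Qed.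

Lemma cmod_ge0 x : 0 <= cmod x.
Proof. by rewrite -ler0c -cmodE. Qed.

Lemma cmod0 : cmod 0 = 0. Proof. exact: Normc.normc0. Qed.
Lemma cmod1 : cmod 1 = 1. Proof. exact: Normc.normc1. Qed.

Lemma cmodM x y : cmod (x * y) = cmod x * cmod y.
Proof. exact: Normc.normcM. Qed.

Lemma cmodV x : cmod x^-1 = (cmod x)^-1.
Proof. exact: Normc.normcV. Qed.

Lemma cmodX x k : cmod (x ^+ k) = cmod x ^+ k.
Proof. by elim: k => [|k IH]; rewrite ?expr0 ?cmod1 // !exprS cmodM IH. Qed.

Lemma cmodD x y : cmod (x + y) <= cmod x + cmod y.
Proof. exact: le_normcD. Qed.

Lemma cmodN x : cmod (- x) = cmod x.
Proof. exact: normcN. Qed.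

Lemma cmodB x y : cmod (x - y) = cmod (y - x).
Proof. by rewrite -cmodN opprB. Qed.

Lemma cmodBD x y : cmod (x - y) <= cmod x + cmod y.
Proof. by rewrite -[cmod y]cmodN; exact: cmodD. Qed.

Lemma cmod_eq0 x : (cmod x == 0) = (x == 0).
Proof.
by apply/eqP/eqP => [|->]; [exact: Normc.eq0_normc | exact: cmod0].
Qed.

Lemma cmod_gt0 x : (0 < cmod x) = (x != 0).
Proof. by rewrite lt_neqAle cmod_ge0 andbT eq_sym cmod_eq0. Qed.

Lemma cmodR (a : R) : cmod a%:C = `|a|.
Proof. by rewrite /cmod /= expr0n addr0 sqrtr_sqr. Qed.

Lemma cmod_nat k : cmod k%:R = k%:R.
Proof. by rewrite -[k%:R](rmorph_nat (real_complex R)) cmodR normr_nat. Qed.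

Lemma cmod_Re x : `|complex.Re x| <= cmod x.
Proof. by rewrite -lecR -cmodE normc_ge_Re. Qed.

Lemma cmod_Im x : `|complex.Im x| <= cmod x.
Proof.
case: x => a b; rewrite /cmod /= -sqrtr_sqr ler_wsqrtr //.
by rewrite lerDr sqr_ge0.
Qed.

Lemma cmod_ReIm x : cmod x <= `|complex.Re x| + `|complex.Im x|.
Proof.
rewrite {1}[x]complexE (le_trans (cmodD _ _)) // cmodM !cmodR.
by rewrite /cmod /= expr0n /= add0r expr1n sqrtr1 mul1r.
Qed.

Lemma cmod_sum k (G : 'I_k -> R[i]) : cmod (\sum_i G i) <= \sum_i cmod (G i).
Proof.
elim/big_ind2: _ => [|a b c d hab hcd|//]; first by rewrite cmod0.
exact: le_trans (cmodD _ _) (lerD hab hcd).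
Qed.

(** A positive element of [R[i]] is real, so the radii of balls can be taken in [R]. *)
Lemma near_complexP x (P : R[i] -> Prop) :
  (\forall y \near x, P y) <->
  exists2 d : R, 0 < d & forall y, cmod (y - x) < d -> P y.
Proof.
split=> [/nbhs_ballP[e /= e0 he]|[d d0 hd]].
  have eR : e = (complex.Re e)%:C by rewrite RRe_real // gtr0_real.
  exists (complex.Re e); first by rewrite -ltcR -eR.
  move=> y hy; apply: he; rewrite -ball_normE /= distrC cmodE eR.
  by rewrite ltcR.
apply/nbhs_ballP; exists d%:C => /=; first by rewrite ltcR.
by move=> y; rewrite -ball_normE /= distrC cmodE ltcR => /hd.
Qed.

(** In one variable, differentiability amounts to a derivative along 1. Multiplying the difference
    quotient by [h] gives an estimate that also covers [h = 0]. *)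
Lemma differentiable_complexP F x : differentiable F x <->
  exists D, forall e : R, 0 < e -> exists2 d : R, 0 < d &
    forall h, cmod h < d -> cmod (F (x + h) - F x - D * h) <= e * cmod h.
Proof.
split=> [/derivable1_diffP dF | [D hD]].
  exists ('D_1 F x) => e e0.
  have : \forall h \near (0 : R[i])^',
      `|'D_1 F x - h^-1 *: ((F \o shift x) (h *: (1 : R[i])) - F x)| < e%:C.
    by have /cvgr_dist_lt := dF; apply; rewrite ltcR.
  rewrite /dnbhs /within /= => /near_complexP[d d0 hd].
  exists d => // h hh; have [->|h0] := eqVneq h 0.
    by rewrite addr0 mulr0 subrr subr0 cmod0 mulr0.
  have := hd h; rewrite subr0 => /(_ hh h0); rewrite cmodE ltcR => /ltW.
  rewrite -(ler_pM2r (x := cmod h)) ?cmod_gt0 // -cmodM => hh2; apply: le_trans hh2.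
  rewrite -cmodN opprB le_eqVlt; apply/orP; left; apply/eqP.
  congr (cmod _); rewrite /shift /= !/(_ *: _) /= mulr1 [h + x]addrC.
  by rewrite mulrBl mulrAC mulVf // mul1r.
apply/derivable1_diffP; apply/cvg_ex; exists D.
apply/cvgrPdist_le => e e0.
have eR : e = (complex.Re e)%:C by rewrite RRe_real // gtr0_real.
have [|d d0 hd] := hD (complex.Re e); first by rewrite -ltcR -eR.
rewrite /dnbhs /within /=; apply/near_complexP; exists d => // h.
rewrite subr0 => hh h0; rewrite cmodE eR lecR.
rewrite -(ler_pM2r (x := cmod h)) ?cmod_gt0 // -cmodM.
apply: le_trans (hd h hh); rewrite -[leRHS]cmodN opprB le_eqVlt; apply/orP; left.
apply/eqP; congr (cmod _); rewrite /shift /= !/(_ *: _) /= mulr1 [h + x]addrC.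
by rewrite mulrBl mulrAC mulVf // mul1r.
Qed.

End ComplexModulus.

(** * The complex exponential and its logarithm on the right half-plane *)

Section ComplexExponential.
Variable R : realType.
Implicit Types (z w : R[i]).

Lemma is_derive_tangent (f : R -> R) (x D : R) : is_derive x 1 f D ->
  forall e : R, 0 < e -> exists2 d : R, 0 < d &
    forall h, `|h| < d -> `|f (x + h) - f x - D * h| <= e * `|h|.
Proof.
move=> dF e e0; have [dv <-] := dF.
have : \forall h \near (0 : R)^',
    `|'D_1 f x - h^-1 *: ((f \o shift x) (h *: (1 : R)) - f x)| < e.
  by have /cvgr_dist_lt := dv; apply.
rewrite /dnbhs /within /= => /nbhs_ballP[d /= d0 hd]; exists d => // h hh.
have [->|h0] := eqVneq h 0; first by rewrite addr0 mulr0 subrr subr0 normr0 mulr0.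
have := hd h; rewrite -ball_normE /= sub0r normrN => /(_ hh h0) /ltW.
rewrite -(ler_pM2r (x := `|h|)) ?normr_gt0 // -normrM => hh2.
apply: le_trans hh2; rewrite -normrN opprB le_eqVlt; apply/orP; left.
apply/eqP; congr (`|_|); rewrite /shift /= !/(_ *: _) /= mulr1 [h + x]addrC.
by rewrite mulrBl mulrAC mulVf // mul1r.
Qed.

Lemma cexp0 : cexp (0 : R[i]) = 1.
Proof.
rewrite /cexp /= expR0 cos0 sin0; apply/eqP.
by rewrite eq_complex /= !mul1r !mul0r subr0 addr0 !eqxx.
Qed.

Lemma cexpD z w : cexp (z + w) = cexp z * cexp w.
Proof.
case: z w => [a b] [c d]; rewrite /cexp /= expRD cosD sinD.
by apply/eqP; rewrite eq_complex /=; apply/andP; split; apply/eqP; ring.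
Qed.

Lemma cexpN z : cexp (- z) = (cexp z)^-1.
Proof.
have h : cexp z * cexp (- z) = 1 by rewrite -cexpD subrr cexp0.
have z0 : cexp z != 0.
  by apply/eqP => z0; move/eqP: h; rewrite z0 mul0r eq_sym oner_eq0.
by apply: (mulfI z0); rewrite h divff.
Qed.

Lemma cexp_neq0 z : cexp z != 0.
Proof.
apply/eqP => z0; have /eqP := cexpD z (- z).
by rewrite subrr cexp0 z0 mul0r oner_eq0.
Qed.

Lemma cmod_cexp z : cmod (cexp z) = expR (complex.Re z).
Proof.
rewrite cmodM cmodR ger0_norm ?expR_ge0 // /cmod /= cos2Dsin2.
by rewrite sqrtr1 mulr1.
Qed.

Lemma cexp_2pi z : cexp (z + (0 +i* (pi *+ 2))) = cexp z.
Proof.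
rewrite cexpD; suff -> : cexp (0 +i* (pi *+ 2)) = 1 :> R[i] by rewrite mulr1.
by rewrite /cexp /= expR0 cos2pi sin2pi mul1r.
Qed.

(** The real and imaginary parts of [cexp h - 1 - h] are combinations of the first-order errors of
    the real [exp], [cos] and [sin] at 0. *)
Lemma cexp_tangent (e : R) : 0 < e -> exists2 d : R, 0 < d &
  forall h, cmod h < d -> cmod (cexp h - 1 - h) <= e * cmod h.
Proof.
(* The errors below add up to [7 * (q * N)], which [e / 8] absorbs; the cap 1 gives the bounds 2 on
   [1 + x] and [2 * N] on [sin y]. *)
move=> e0; pose q := Num.min (e / 8) 1.
have q0 : 0 < q by rewrite lt_min ltr01 andbT; lra.
have [q1 q2] : q <= e / 8 /\ q <= 1 by split; rewrite ge_min lexx ?orbT.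
clearbody q.
have [d1 d10 h1] := is_derive_tangent (is_derive_expR (0 : R)) q0.
have [d2 d20 h2] := is_derive_tangent (is_derive_cos (0 : R)) q0.
have [d3 d30 h3] := is_derive_tangent (is_derive_sin (0 : R)) q0.
exists (Num.min (Num.min d1 d2) (Num.min d3 q)).
  by rewrite !lt_min d10 d20 d30 q0.
move=> h; rewrite !lt_min => /andP[/andP[hd1 hd2] /andP[hd3 hq]].
have hx := cmod_Re h; have hy := cmod_Im h.
set x := complex.Re h in hx *; set y := complex.Im h in hy *.
have {}h1 := h1 x (le_lt_trans hx hd1).
have {}h2 := h2 y (le_lt_trans hy hd2).
have {}h3 := h3 y (le_lt_trans hy hd3).
rewrite !add0r expR0 mul1r in h1; rewrite !add0r cos0 sin0 oppr0 mul0r subr0 in h2.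
rewrite !add0r cos0 sin0 mul1r subr0 in h3.
apply: le_trans (cmod_ReIm _) _.
have -> : complex.Re (cexp h - 1 - h) = (expR x - 1 - x) * cos y + (1 + x) * (cos y - 1).
  by rewrite /x /y /cexp; case: (h) => a b /=; ring.
have -> : complex.Im (cexp h - 1 - h) = (expR x - 1 - x) * sin y + x * sin y + (sin y - y).
  by rewrite /x /y /cexp; case: (h) => a b /=; ring.
have cy : `|cos y| <= 1 by rewrite ler_norml cos_geN1 cos_le1.
have sy : `|sin y| <= 1 by rewrite ler_norml sin_geN1 sin_le1.
have N0 := cmod_ge0 h.
set N := cmod h in hx hy hq N0 *.
have n1 := normr_ge0 x; have n2 := normr_ge0 y.
have k1 : `|(expR x - 1 - x) * cos y| <= q * N.
  rewrite normrM; apply: le_trans (ler_pM _ _ h1 cy) _ => //.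
  by rewrite mulr1 ler_pM2l.
have k2 : `|(expR x - 1 - x) * sin y| <= q * N.
  rewrite normrM; apply: le_trans (ler_pM _ _ h1 sy) _ => //.
  by rewrite mulr1 ler_pM2l.
have k3 : `|(1 + x) * (cos y - 1)| <= 2 * (q * N).
  rewrite normrM; apply: ler_pM => //.
    by apply: le_trans (ler_normD _ _) _; rewrite normr1; lra.
  by apply: le_trans h2 _; rewrite ler_pM2l.
have k5 : `|sin y - y| <= q * N by apply: le_trans h3 _; rewrite ler_pM2l.
have k6 : `|sin y| <= 2 * N.
  rewrite -[sin y](subrK y); apply: le_trans (ler_normD _ _) _.
  have : q * N <= 1 * N by apply: ler_wpM2r.
  by lra.
have k4 : `|x * sin y| <= q * (2 * N).
  by rewrite normrM; apply: ler_pM => //; lra.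
have a1 := ler_normD ((expR x - 1 - x) * cos y) ((1 + x) * (cos y - 1)).
have a2 := ler_normD ((expR x - 1 - x) * sin y + x * sin y) (sin y - y).
have a3 := ler_normD ((expR x - 1 - x) * sin y) (x * sin y).
have k7 : q * N <= (e / 8) * N by apply: ler_wpM2r.
apply: le_trans (lerD a1 (le_trans a2 (lerD a3 (lexx _)))) _.
apply: le_trans (lerD (lerD k1 k3) (lerD (lerD k2 k4) k5)) _.
have -> : q * N + 2 * (q * N) + (q * N + q * (2 * N) + q * N) = 7 * (q * N) by ring.
have -> : e * N = 8 * (e / 8 * N) by field.
have : 0 <= q * N by rewrite mulr_ge0 // ltW.
lra.
Qed.

Lemma differentiable_cexp z : differentiable (@cexp R) z.
Proof.
apply/differentiable_complexP; exists (cexp z) => e e0.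
have c0 := expR_gt0 (complex.Re z).
have [d d0 hd] := cexp_tangent (divr_gt0 e0 c0).
exists d => // h /hd hh; rewrite cexpD.
have -> : cexp z * cexp h - cexp z - cexp z * h = cexp z * (cexp h - 1 - h) by ring.
rewrite cmodM cmod_cexp; move: hh; rewrite -(ler_pM2l c0).
by rewrite mulrA mulrCA divff ?mulr1 ?gt_eqF.
Qed.

(** The modulus forces the real part to be 0; the sine of the imaginary part then vanishes, and
    [1 < pi] leaves only 0. *)
Lemma cexp_eq1_small z : cexp z = 1 -> `|complex.Im z| <= 1 -> z = 0.
Proof.
move=> z1 hz; have : cmod (cexp z) = 1 by rewrite z1 cmod1.
rewrite cmod_cexp -expR0 => /expR_inj x0.
suff y0 : complex.Im z = 0 by rewrite [z]complexE x0 y0 mulr0 addr0.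
move: z1; rewrite /cexp x0 expR0 => /eqP.
rewrite mul1r eq_complex /= => /andP[/eqP c1 /eqP s0].
have pi1 : (1 : R) < pi by have := pi_ge2 R; lra.
have [y0|y0|//] := ltrgt0P (complex.Im z).
- have : 0 < sin (complex.Im z).
    by rewrite sin_gt0_pi // y0 /=; move: hz; rewrite gtr0_norm //; lra.
  by rewrite s0 ltxx.
- have : 0 < sin (- complex.Im z).
    by rewrite sin_gt0_pi // oppr_gt0 y0 /=; move: hz; rewrite ltr0_norm //; lra.
  by rewrite sinN s0 oppr0 ltxx.
Qed.

(* A logarithm only on the half-plane [Re z > 0]; a junk value elsewhere. *)
Definition clog z : R[i] :=
  ln (cmod z) +i* atan (complex.Im z / complex.Re z).

(** Polar form: for [x > 0] the angle [atan (y / x)] has cosine [x / cmod z] and sine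
    [y / cmod z]. *)
Lemma clogK z : 0 < complex.Re z -> cexp (clog z) = z.
Proof.
case: z => x y /= x0.
have m0 : 0 < cmod (x +i* y) by rewrite (lt_le_trans _ (cmod_Re _)) //= gtr0_norm.
have c0 : 0 < cos (atan (y / x)) by rewrite cos_atan invr_gt0 sqrtr_gt0 ltr_wpDr ?sqr_ge0.
rewrite /clog /cexp /= lnK //.
have e1 : cmod (x +i* y) = x * Num.sqrt (1 + (y / x) ^+ 2).
  rewrite /cmod /= -{2}[x]gtr0_norm // -sqrtr_sqr -sqrtrM ?sqr_ge0 //.
  by congr Num.sqrt; field; rewrite gt_eqF.
have e2 : x = cmod (x +i* y) * cos (atan (y / x)).
  by rewrite cos_atan e1 mulfK // gt_eqF // sqrtr_gt0 ltr_wpDr ?sqr_ge0.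
have e3 : y = cmod (x +i* y) * sin (atan (y / x)).
  have := atanK (y / x); rewrite /tan => /(congr1 (fun t => t * cos (atan (y/x)))).
  rewrite mulfVK ?gt_eqF // => ->; rewrite mulrCA -e2 mulfVK ?gt_eqF //.
by apply/eqP; rewrite eq_complex /= !mul0r subr0 addr0 -e2 -e3 !eqxx.
Qed.

(** Since [1 < pi / 2], the imaginary part lies where [atan] inverts [tan]. *)
Lemma cexpK z : `|complex.Im z| <= 1 -> clog (cexp z) = z.
Proof.
case: z => x y /= hy; rewrite /clog cmod_cexp expRK.
have pi1 : (1 : R) < pi / 2.
  rewrite lt_neqAle pihalf_ge1 andbT; apply/eqP => h1.
  by have := @cos1_gt0 R; rewrite h1 cos_pihalf ltxx.
rewrite /cexp /= !mul0r subr0 addr0; congr (_ +i* _).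
rewrite -mulf_div divff ?gt_eqF ?expR_gt0 // mul1r tanK //.
by rewrite in_itv /=; move: hy; rewrite ler_norml => /andP[]; lra.
Qed.

End ComplexExponential.

(** * Goursat's lemma for Riemann sums around parallelograms *)

Section DiscreteGoursat.
Variable R : realType.
Implicit Types (F : R[i] -> R[i]) (w v e : R[i]).

(** Left-endpoint sum for the integral of [F] from [w] to [w + e]. The number of pieces is a power
    of two, so that halving an edge respects the subdivision. *)
Definition edge_sum F m w e : R[i] :=
  \sum_(k < 2 ^ m) F (w + k%:R * (e / 2 ^+ m)) * (e / 2 ^+ m).

(** Stands for the contour integral. Reversed sides are sampled forwards and negated, so that sides
    shared by adjacent parallelograms cancel exactly. *)
Definition boundary_sum F m w e1 e2 : R[i] :=
  edge_sum F m w e1 - edge_sum F m (w + e2) e1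
  + (edge_sum F m (w + e1) e2 - edge_sum F m w e2).

Lemma edge_sumD F m w e :
  edge_sum F m.+1 w (e + e) = edge_sum F m w e + edge_sum F m (w + e) e.
Proof.
have n0 : (2 : R[i]) ^+ m != 0 by rewrite expf_neq0 // pnatr_eq0.
have e2 : (e + e) / 2 ^+ m.+1 = e / 2 ^+ m by rewrite exprS; field.
rewrite /edge_sum e2 expnS mul2n -addnn big_split_ord /=; congr (_ + _).
apply: eq_bigr => k _; congr (F _ * _).
rewrite natrD mulrDl addrA; congr (_ + _ + _).
by rewrite natrX mulrC mulfVK.
Qed.

(** Each inner edge of the four quarters occurs twice, with opposite signs. *)
Lemma boundary_sumD F m w a b :
  boundary_sum F m.+1 w (a + a) (b + b) =
    boundary_sum F m w a b + boundary_sum F m (w + a) a b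
    + boundary_sum F m (w + b) a b + boundary_sum F m (w + a + b) a b.
Proof.
rewrite /boundary_sum !edge_sumD !addrA.
rewrite ![w + b + a]addrAC ![w + a + b + a]addrAC ![w + b + b + a]addrAC.
rewrite ![w + b + a]addrAC; ring.
Qed.

(** Translation by [v] changes every sample by [D * v], so parallel edges have the same
    discretisation error. The difference [D * v * e] is symmetric in [v] and [e], hence the two
    pairs of opposite sides cancel. *)
Lemma edge_sum_const_shift m w v e c D :
  edge_sum (fun z => c + D * z) m (w + v) e =
  edge_sum (fun z => c + D * z) m w e + D * v * e.
Proof.
have n0 : (2 : R[i]) ^+ m != 0 by rewrite expf_neq0 // pnatr_eq0.
have -> : D * v * e = \sum_(k < 2 ^ m) (D * v * (e / 2 ^+ m)).
  by rewrite sumr_const card_ord -[RHS]mulr_natl natrX; field.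
rewrite -big_split; apply: eq_bigr => k _ /=; ring.
Qed.

Lemma boundary_sum_affine m w e1 e2 c D :
  boundary_sum (fun z => c + D * z) m w e1 e2 = 0.
Proof. by rewrite /boundary_sum !edge_sum_const_shift; ring. Qed.

Lemma edge_sumB F G m w e :
  edge_sum (fun z => F z - G z) m w e = edge_sum F m w e - edge_sum G m w e.
Proof. by rewrite -sumrB; apply: eq_bigr => k _; rewrite mulrBl. Qed.

Lemma edge_sum_bound F m w e (b : R) :
  (forall s : R, 0 <= s <= 1 -> cmod (F (w + s%:C * e)) <= b) ->
  cmod (edge_sum F m w e) <= b * cmod e.
Proof.
move=> hF; apply: le_trans (cmod_sum _) _.
have n0 : (0 : R) < 2 ^+ m by rewrite exprn_gt0.
have -> : b * cmod e = \sum_(k < 2 ^ m) (b * (cmod e / 2 ^+ m)).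
  by rewrite sumr_const card_ord -[RHS]mulr_natl natrX; field; rewrite gt_eqF.
apply: ler_sum => k _; rewrite cmodM.
have c2 : cmod (e / 2 ^+ m) = cmod e / 2 ^+ m.
  by rewrite cmodM cmodV cmodX cmod_nat.
rewrite c2 ler_wpM2r ?divr_ge0 ?cmod_ge0 ?(ltW n0) //.
have -> : k%:R * (e / 2 ^+ m) = (k%:R / 2 ^+ m)%:C * e.
  rewrite rmorphM /= fmorphV rmorphXn /= !rmorph_nat; ring.
apply: hF; rewrite divr_ge0 ?(ltW n0) //= ler_pdivrMr // mul1r.
by rewrite -natrX ler_nat ltnW.
Qed.

(** Subtracting an affine function does not change the boundary sum; the factor 2 counts the two
    sides in each direction. *)
Lemma boundary_sum_bound F m w e1 e2 c D (b : R) :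
  (forall s t : R, 0 <= s <= 1 -> 0 <= t <= 1 ->
    cmod (F (w + s%:C * e1 + t%:C * e2) - (c + D * (w + s%:C * e1 + t%:C * e2))) <= b) ->
  cmod (boundary_sum F m w e1 e2) <= 2 * b * (cmod e1 + cmod e2).
Proof.
move=> hF; pose G z := F z - (c + D * z).
have -> : boundary_sum F m w e1 e2 = boundary_sum G m w e1 e2.
  rewrite -[LHS]subr0 -(boundary_sum_affine m w e1 e2 c D) /boundary_sum /G.
  by rewrite !edge_sumB; ring.
have i01 : 0 <= (0 : R) <= 1 by rewrite lexx ler01.
have i11 : 0 <= (1 : R) <= 1 by rewrite lexx ler01.
have b1 : cmod (edge_sum G m w e1) <= b * cmod e1.
  apply: edge_sum_bound => s hs; have := hF s 0 hs i01.
  by rewrite mul0r addr0.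
have b2 : cmod (edge_sum G m (w + e2) e1) <= b * cmod e1.
  apply: edge_sum_bound => s hs; have := hF s 1 hs i11.
  by rewrite mul1r addrAC.
have b3 : cmod (edge_sum G m (w + e1) e2) <= b * cmod e2.
  apply: edge_sum_bound => t ht; have := hF 1 t i11 ht.
  by rewrite mul1r.
have b4 : cmod (edge_sum G m w e2) <= b * cmod e2.
  apply: edge_sum_bound => t ht; have := hF 0 t i01 ht.
  by rewrite mul0r addr0.
apply: le_trans (cmodD _ _) _.
apply: le_trans (lerD (cmodBD _ _) (cmodBD _ _)) _.
apply: le_trans (lerD (lerD b1 b2) (lerD b3 b4)) _.
by rewrite le_eqVlt; apply/orP; left; apply/eqP; ring.
Qed.

(** The intervals of length [1 / 2 ^ j] starting at [a j] are nested, so the supremum of the left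
    endpoints lies in all of them. *)
Lemma nested_dyadic (a : nat -> R) (b : nat -> bool) :
  (forall j, a j.+1 = a j + (b j)%:R / 2 ^+ j.+1) ->
  exists x, forall j, a j <= x <= a j + 1 / 2 ^+ j.
Proof.
move=> ha.
have p0 j : (0 : R) < 2 ^+ j by rewrite exprn_gt0.
have half j : 1 / 2 ^+ j = 1 / 2 ^+ j.+1 + 1 / 2 ^+ j.+1 :> R.
  by rewrite exprS; field; rewrite gt_eqF.
have up j : a j <= a j.+1.
  by rewrite ha lerDl divr_ge0 // ltW.
have dn j : a j.+1 + 1 / 2 ^+ j.+1 <= a j + 1 / 2 ^+ j.
  rewrite ha (half j) -addrA lerD2l lerD2r ler_pM2r ?invr_gt0 //.
  by case: (b j).
have upk j k : a j <= a (j + k)%N.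
  by elim: k => [|k IH]; rewrite ?addn0 // addnS; apply: le_trans IH (up _).
have dnk j k : a (j + k)%N + 1 / 2 ^+ (j + k) <= a j + 1 / 2 ^+ j.
  by elim: k => [|k IH]; rewrite ?addn0 // addnS; apply: le_trans (dn _) IH.
have bd j k : a k <= a j + 1 / 2 ^+ j.
  have [jk|kj] := leqP j k.
    rewrite -(subnKC jk); apply: le_trans (dnk j (k - j)%N).
    by rewrite lerDl divr_ge0 // ltW.
  rewrite -(subnKC (ltnW kj)); apply: le_trans (upk k (j - k)%N) _.
  by rewrite lerDl divr_ge0 // ltW.
exists (sup (range a)) => j; apply/andP; split.
  apply: ub_le_sup; last by exists j.
  by exists (a 0%N + 1 / 2 ^+ 0) => _ [k _ <-].
by apply: ge_sup; [exists (a 0%N); exists 0%N | move=> _ [k _ <-]].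
Qed.

(** If the bound fails, it fails on some quarter with a quarter of the tolerance, and so on down to
    a limit point. There the tangent bounds the sum at level [j] by a small multiple of [4 ^ (- j)],
    a contradiction. *)
Lemma goursat F : (forall z, differentiable F z) ->
  forall w e1 e2 (e : R), 0 < e ->
  exists M, forall m, (M <= m)%N -> cmod (boundary_sum F m w e1 e2) <= e.
Proof.
move=> dF w e1 e2 e e0.
pose good w e1 e2 (e : R) :=
  exists M, forall m, (M <= m)%N -> cmod (boundary_sum F m w e1 e2) <= e.
rewrite -[exists _, _]/(good w e1 e2 e).
apply: contrapT => bad.
have step w' a b (r : R) : ~ good w' a b r -> exists ij : bool * bool,
    ~ good (w' + ij.1%:R * (a / 2) + ij.2%:R * (b / 2)) (a / 2) (b / 2) (r / 4).
  move=> nb; apply: contrapT => /forallNP hg; apply: nb.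
  have hgood ij := contrapT (hg ij).
  have [M1 h1] := hgood (false, false); have [M2 h2] := hgood (true, false).
  have [M3 h3] := hgood (false, true); have [M4 h4] := hgood (true, true).
  (* The successor pays for the bisection: level [m.+1] on the whole is level [m] on each
     quarter. *)
  exists (maxn (maxn M1 M2) (maxn M3 M4)).+1 => -[//|m].
  rewrite ltnS !geq_max => /andP[/andP[k1 k2] /andP[k3 k4]].
  move: {h1 h2 h3 h4} (h1 m k1) (h2 m k2) (h3 m k3) (h4 m k4) => /=.
  rewrite !mul0r !mul1r !addr0 => h1 h2 h3 h4.
  have halve (z : R[i]) : z = z / 2 + z / 2 by field.
  rewrite [in boundary_sum _ _ _ a _](halve a) [in boundary_sum _ _ _ _ b](halve b).
  rewrite boundary_sumD.
  apply: le_trans (cmodD _ _) _; apply: le_trans (lerD (cmodD _ _) (lexx _)) _.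
  apply: le_trans (lerD (lerD (cmodD _ _) (lexx _)) (lexx _)) _.
  by lra.
have p0 j : (0 : R) < 2 ^+ j by rewrite exprn_gt0.
have c0 j : (2 : R[i]) ^+ j != 0 by rewrite expf_neq0 // pnatr_eq0.
(* A state is a bisection level together with the coordinates of the corner of the current cell in
   the frame [e1], [e2]. *)
pose P (x : nat * (R * R)) := ~ good (w + x.2.1%:C * e1 + x.2.2%:C * e2)
  (e1 / 2 ^+ x.1) (e2 / 2 ^+ x.1) (e / 4 ^+ x.1).
pose nxt (x : nat * (R * R)) (ij : bool * bool) : nat * (R * R) :=
  (x.1.+1, (x.2.1 + ij.1%:R / 2 ^+ x.1.+1, x.2.2 + ij.2%:R / 2 ^+ x.1.+1)).
have Pnext x : exists ij, P x -> P (nxt x ij).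
  have [Px|] := pselect (P x); last by exists (true, true).
  have [ij hij] := step _ _ _ _ Px; exists ij => _.
  move: hij; rewrite /P /nxt /=.
  rewrite !rmorphD !rmorphM /= !fmorphV !rmorphXn /= !rmorph_nat.
  have hy (y : R[i]) : y / 2 ^+ x.1 / 2 = y / 2 ^+ x.1.+1.
    by rewrite exprSr invfM mulrA.
  rewrite !hy.
  have -> : e / 4 ^+ x.1 / 4 = e / 4 ^+ x.1.+1.
    by rewrite exprSr invfM mulrA.
  have hw (a b c d : R[i]) : w + a * e1 + b * e2 + c * (e1 / 2 ^+ x.1.+1) + d * (e2 / 2 ^+ x.1.+1)
     = w + (a + c / 2 ^+ x.1.+1) * e1 + (b + d / 2 ^+ x.1.+1) * e2 by ring.
  by rewrite hw.
have [pick hpick] := boolp.choice Pnext.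
pose st := fix st j := if j is k.+1 then nxt (st k) (pick (st k)) else (0%N, (0, 0)).
have st1 j : (st j).1 = j by elim: j => //= j ->.
have stP j : P (st j).
  elim: j => [|j IH] /=; last exact: hpick.
  by rewrite /P /= !mul0r !addr0 !expr0 !divr1.
have [|x hx] := @nested_dyadic (fun j => (st j).2.1) (fun j => (pick (st j)).1).
  by move=> j /=; rewrite st1.
have [|y hy] := @nested_dyadic (fun j => (st j).2.2) (fun j => (pick (st j)).2).
  by move=> j /=; rewrite st1.
pose ws := w + x%:C * e1 + y%:C * e2.
have [D hD] := (differentiable_complexP F ws).1 (dF ws).
pose S := cmod e1 + cmod e2.
have S0 : 0 <= S by rewrite addr_ge0 ?cmod_ge0.
(* Chosen so that [2 * kap * S ^+ 2 <= e]; the added 1 keeps the denominator positive when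
   [S = 0]. *)
pose kap := e / (2 * S ^+ 2 + 1).
have den0 : 0 < 2 * S ^+ 2 + 1 by have := sqr_ge0 S; lra.
have kap0 : 0 < kap by rewrite divr_gt0.
have [d d0 hd] := hD kap kap0.
have [j hj] : exists j : nat, S / 2 ^+ j < d.
  have [k hk] : exists k : nat, S / d < k%:R.
    by exists (Num.bound (S / d)); apply: archi_boundP; rewrite divr_ge0 // ltW.
  exists k; rewrite ltr_pdivrMr // mulrC -ltr_pdivrMr //.
  by apply: lt_le_trans hk _; rewrite -natrX ler_nat ltnW // ltn_expl.
have := stP j; rewrite /P st1; apply; exists 0%N => m _.
set a := (st j).2.1; set b := (st j).2.2.
have {}hx := hx j; have {}hy := hy j; rewrite -/a -/b in hx hy.
have cE (v : R[i]) : cmod (v / 2 ^+ j) = cmod v / 2 ^+ j.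
  by rewrite cmodM cmodV cmodX cmod_nat.
(* The affine function is the tangent of [F] at the limit point [ws]. *)
have hb := @boundary_sum_bound F m (w + a%:C * e1 + b%:C * e2)
  (e1 / 2 ^+ j) (e2 / 2 ^+ j) (F ws - D * ws) D (kap * (S / 2 ^+ j)).
apply: le_trans (hb _) _; last first.
  rewrite !cE -mulrDl -/S.
  have -> : (4 : R) ^+ j = 2 ^+ j * 2 ^+ j by rewrite -exprMn; congr (_ ^+ _); ring.
  have -> : 2 * (kap * (S / 2 ^+ j)) * (S / 2 ^+ j) = (2 * kap * S ^+ 2) / (2 ^+ j * 2 ^+ j).
    by field; rewrite gt_eqF.
  rewrite ler_pM2r ?invr_gt0 ?mulr_gt0 //.
  rewrite /kap mulrAC mulrA ler_pdivrMr //; have := sqr_ge0 S; nra.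
move=> s t hs ht; set z := _ + t%:C * _.
have dz : z - ws = (a + s / 2 ^+ j - x)%:C * e1 + (b + t / 2 ^+ j - y)%:C * e2.
  rewrite /z /ws !rmorphB !rmorphD !rmorphM /= !fmorphV !rmorphXn /= !rmorph_nat.
  by ring.
have near1 (u v r : R) : 0 <= r <= 1 -> u <= v <= u + 1 / 2 ^+ j ->
    `|u + r / 2 ^+ j - v| <= 1 / 2 ^+ j.
  move=> /andP[r0 r1] /andP[uv vu].
  have q0 : 0 <= r / 2 ^+ j by rewrite divr_ge0 // ltW.
  have q1 : r / 2 ^+ j <= 1 / 2 ^+ j by rewrite ler_pM2r ?invr_gt0.
  by rewrite ler_norml; apply/andP; split; lra.
have zs : cmod (z - ws) <= S / 2 ^+ j.
  rewrite dz; apply: le_trans (cmodD _ _) _; rewrite !cmodM !cmodR.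
  have -> : S / 2 ^+ j = 1 / 2 ^+ j * cmod e1 + 1 / 2 ^+ j * cmod e2 by rewrite /S; ring.
  by apply: lerD; rewrite ler_wpM2r ?cmod_ge0 // near1.
have := hd (z - ws) (le_lt_trans zs hj); rewrite subrKC.
have -> : F z - F ws - D * (z - ws) = F z - (F ws - D * ws + D * z) by ring.
move=> h; apply: le_trans h _; rewrite ler_pM2l //.
Qed.

End DiscreteGoursat.

(** * Mean value bound and identity theorem *)

Section IdentityTheorem.
Variable R : realType.
Implicit Types (F : R[i] -> R[i]) (p c : R[i]).

Lemma edge_sum_cst (c : R[i]) m w e : edge_sum (fun=> c) m w e = c * e.
Proof.
have n0 : (2 : R[i]) ^+ m != 0 by rewrite expf_neq0 // pnatr_eq0.
by rewrite /edge_sum sumr_const card_ord -[LHS]mulr_natl natrX; field.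
Qed.

Lemma cexp_ReIm (a b : R) : cmod (cexp (a +i* b)) = expR a.
Proof. by rewrite cmod_cexp. Qed.

Lemma differentiable_exp_chart F p : (forall z, differentiable F z) ->
  forall w, differentiable (fun w => F (p + cexp w)) w.
Proof.
move=> dF w; have dp : differentiable (fun w => p + cexp w) w.
  exact: (differentiableD (differentiable_cst p w) (@differentiable_cexp R w)).
exact: (differentiable_comp dp (dF _)).
Qed.

(* Goursat for [F (p + exp w)] on a rectangle of height [2 pi]: the two
   horizontal sides cancel by periodicity, and the left side, far to the left,
   is a small circle around [p]. *)
Lemma mean_value_bound F p (b M : R) : (forall z, differentiable F z) ->
  (forall t, 0 <= t <= pi *+ 2 -> cmod (F (p + cexp (b +i* t))) <= M) -> cmod (F p) <= M.
Proof.
move=> dF hM; apply/ler_addgt0Pr => e e0; pose q := e / 2.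
have q0 : 0 < q by rewrite divr_gt0.
have : {for p, continuous F} by exact: differentiable_continuous.
move=> /cvgrPdist_le /(_ q%:C); rewrite ltcR => /(_ q0) /near_complexP[d d0 hd].
(* The left side of the rectangle becomes the circle of radius [d / 2], on which [F] is within [q]
   of [F p]. *)
pose a : R := ln (d / 2).
have d20 : 0 < d / 2 by rewrite divr_gt0.
pose H w := F (p + cexp w).
have dH := differentiable_exp_chart p dF : forall w, differentiable H w.
have Hper w : H (w + (0 +i* (pi *+ 2))) = H w by rewrite /H cexp_2pi.
have [m hm] := goursat dH a%:C (b - a)%:C (0 +i* (pi *+ 2)) q0.
have {}hm := hm m (leqnn m).
have pi1 : (1 : R) <= pi *+ 2 by have := pi_ge2 R; rewrite mulr2n; lra.
have c2 : cmod (0 +i* (pi *+ 2) : R[i]) = pi *+ 2.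
  by rewrite /cmod /= expr0n /= add0r sqrtr_sqr ger0_norm //; lra.
move: hm; rewrite /boundary_sum.
have -> : edge_sum H m (a%:C + (0 +i* (pi *+ 2))) (b - a)%:C = edge_sum H m a%:C (b - a)%:C.
  by apply: eq_bigr => k _; rewrite addrAC Hper.
rewrite subrr add0r -rmorphD /= subrKC.
set e2 : R[i] := 0 +i* (pi *+ 2) in c2 *.
have e2E : e2 = 'i%C * (pi *+ 2)%:C by rewrite [LHS]complexE /= add0r.
have hb : cmod (edge_sum H m b%:C e2) <= M * (pi *+ 2).
  rewrite -c2; apply: edge_sum_bound => s /andP[s0 s1].
  have -> : b%:C + s%:C * e2 = b +i* (s * (pi *+ 2)).
    by rewrite e2E [RHS]complexE /= rmorphM /=; ring.
  by apply: hM; rewrite mulr_ge0 ?ler_piMl //; lra.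
have ha : cmod (edge_sum (fun w => H w - F p) m a%:C e2) <= q * (pi *+ 2).
  rewrite -c2; apply: edge_sum_bound => s _.
  have -> : a%:C + s%:C * e2 = a +i* (s * (pi *+ 2)).
    by rewrite e2E [RHS]complexE /= rmorphM /=; ring.
  have := hd (p + cexp (a +i* (s * (pi *+ 2)))).
  rewrite cmodE lecR (cmodB (F p)); apply; rewrite addrC addKr cexp_ReIm lnK //; lra.
move=> hm; rewrite -(ler_pM2r (x := pi *+ 2)); last by lra.
(* [F p * e2] is the sum over the large circle, minus the Goursat defect, minus the deviation from
   [F p] on the small circle. As [1 <= 2 pi], the defect too is at most [q * 2 pi]. *)
rewrite -{1}c2 -cmodM -(edge_sum_cst (F p) m a%:C).
have -> : edge_sum (fun=> F p) m a%:C e2 = edge_sum H m b%:C e2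
   - (edge_sum H m b%:C e2 - edge_sum H m a%:C e2)
   - edge_sum (fun w => H w - F p) m a%:C e2.
  by rewrite edge_sumB; ring.
apply: le_trans (cmodBD _ _) _; apply: le_trans (lerD (cmodBD _ _) (lexx _)) _.
apply: le_trans (lerD (lerD hb hm) ha) _.
have -> : e = q + q by rewrite /q; field.
have : q * 1 <= q * (pi *+ 2) by rewrite ler_pM2l.
by rewrite !mulrDl; lra.
Qed.

Lemma continuous_real_complex : continuous (fun t : R => t%:C : R[i]).
Proof.
move=> x; apply/cvgrPdist_le => e e0.
have eR : e = (complex.Re e)%:C by rewrite RRe_real // gtr0_real.
apply/nbhs_ballP; exists (complex.Re e) => /=; first by rewrite -ltcR -eR.
move=> y yx; have /ltW hy : `|x - y| < complex.Re e := yx.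
by rewrite -rmorphB cmodE cmodR eR lecR.
Qed.

Lemma continuous_of_cmod (f : R[i] -> R) :
  (forall x y, `|f x - f y| <= cmod (x - y)) -> continuous f.
Proof.
move=> hf x; apply/(@cvgrPdist_le _ _ _ (nbhs x) (nbhs_filter x)) => e e0.
apply/near_complexP; exists e => // y hy.
by apply: le_trans (hf x y) _; rewrite cmodB ltW.
Qed.

Lemma continuous_cmod : continuous (@cmod R).
Proof.
apply: continuous_of_cmod => x y; rewrite ler_norml.
have := cmodD (x - y) y; have := cmodD (y - x) x.
by rewrite !subrK (cmodB y) => h1 h2; apply/andP; split; lra.
Qed.

Lemma continuous_Re : continuous (@complex.Re R).
Proof.
apply: continuous_of_cmod => x y; apply: le_trans (cmod_Re _).
by case: x y => [? ?] [? ?].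
Qed.

Lemma continuous_Im : continuous (@complex.Im R).
Proof.
apply: continuous_of_cmod => x y; apply: le_trans (cmod_Im _).
by case: x y => [? ?] [? ?].
Qed.

Lemma circle_bounded F p (b : R) : (forall z, differentiable F z) ->
  exists M : R, forall t, 0 <= t <= pi *+ 2 -> cmod (F (p + cexp (b +i* t))) <= M.
Proof.
move=> dF; pose f (t : R) := cmod (F (p + cexp (b%:C + 'i%C * t%:C))).
have fE t : f t = cmod (F (p + cexp (b +i* t))) by rewrite [b +i* t]complexE.
have pi20 : (0 : R) <= pi *+ 2 by rewrite mulrn_wge0 // pi_ge0.
have cf : continuous f.
  move=> t; pose arg (t : R) : R[i] := b%:C + 'i%C * t%:C.
  have carg : {for t, continuous arg}.
    apply: (@continuousD _ _ _ (fun=> b%:C)); first exact: cst_continuous.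
    apply: (@continuousM _ _ (fun=> 'i%C)); first exact: cst_continuous.
    exact: continuous_real_complex.
  have cH := differentiable_continuous (differentiable_exp_chart p dF (arg t)).
  exact: (continuous_comp (continuous_comp carg cH) (@continuous_cmod _)).
have [c _ hc] := EVT_max pi20 (continuous_subspaceT cf).
by exists (f c) => t ht; rewrite -fE; apply: hc; rewrite in_itv.
Qed.

(** Near [c] the quotient is identically 0, also at [c] itself because its numerator vanishes
    there. *)
Lemma differentiable_div_zero F c N : (forall z, differentiable F z) ->
  (\forall z \near c, F z = 0) ->
  forall z, differentiable (fun z => F z / (z - c) ^+ N) z.
Proof.
move=> dF /near_complexP[d d0 hd] z; have [->|zc] := eqVneq z c.
  apply/differentiable_complexP; exists 0 => e e0; exists d => // h hh.
  rewrite mul0r subr0 !hd ?subrr ?cmod0 //; last by rewrite addrC addKr.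
  by rewrite !mul0r subrr cmod0 mulr_ge0 ?cmod_ge0 ?ltW.
apply: differentiableM; first exact: dF.
apply: differentiableV.
  elim: N => [|N IH]; first by under eq_fun do rewrite expr0; exact: differentiable_cst.
  under eq_fun do rewrite exprS; apply: differentiableM IH.
  exact: (differentiableD (@ex_diff _ _ _ _ _ _ _ (is_diff_id z)) (differentiable_cst (- c) z)).
by rewrite expf_neq0 // subr_eq0.
Qed.

Lemma identity_principle F c : (forall z, differentiable F z) ->
  (\forall z \near c, F z = 0) -> forall p, F p = 0.
Proof.
move=> dF F0 p; have [->|pc] := eqVneq p c; first exact: nbhs_singleton F0.
pose r := cmod (p - c).
have r0 : 0 < r by rewrite cmod_gt0 subr_eq0.
(* On the circle of radius [3 * r] about [p] the distance to [c] is at least [2 * r], against [r] at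
   [p]; each power of [z - c] thus gains a factor 2. *)
have [M hM] := circle_bounded p (ln (3 * r)) dF.
have bound N : cmod (F p) * 2 ^+ N <= M.
  have rN : 0 < r ^+ N by rewrite exprn_gt0.
  have : cmod (F p / (p - c) ^+ N) <= M / (2 * r) ^+ N.
    apply: (@mean_value_bound (fun z => F z / (z - c) ^+ N) p (ln (3 * r))).
      exact: differentiable_div_zero.
    move=> t ht; set w := cexp _; rewrite cmodM cmodV cmodX.
    have hw : 2 * r <= cmod (p + w - c).
      have := cmodD (p + w - c) (c - p).
      have -> : p + w - c + (c - p) = w by ring.
      by rewrite /w cexp_ReIm lnK ?posrE ?mulr_gt0 // (cmodB c p) -/r; lra.
    have hN : (2 * r) ^+ N <= cmod (p + w - c) ^+ N.
      by rewrite lerXn2r // nnegrE ?cmod_ge0 // mulr_ge0 // ltW.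
    have r2N : 0 < (2 * r) ^+ N by rewrite exprn_gt0 // mulr_gt0.
    apply: ler_pM; rewrite ?cmod_ge0 ?invr_ge0 ?exprn_ge0 ?cmod_ge0 //; first exact: hM _ ht.
    by rewrite lef_pV2 // posrE // (lt_le_trans r2N).
  rewrite cmodM cmodV cmodX -/r exprMn.
  rewrite ler_pdivrMr // => /le_trans h.
  rewrite -ler_pdivlMr ?exprn_gt0 //; apply: h.
  by rewrite invfM mulrA mulfVK ?gt_eqF.
apply/eqP; rewrite -cmod_eq0; apply/negPn/negP; rewrite cmod_eq0 -cmod_gt0 => Fp.
have M0 : 0 <= M by apply: le_trans (bound 0%N); rewrite expr0 mulr1 ltW.
have /= hN := archi_boundP (divr_ge0 M0 (ltW Fp)).
set N := Num.bound _ in hN; have := bound N.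
rewrite mulrC -ler_pdivlMr // leNgt => /negP; apply.
by apply: lt_le_trans hN _; rewrite -natrX ler_nat ltnW // ltn_expl.
Qed.

Lemma is_entire_line n (f : 'rV[R[i]]_n -> R[i]) z v : is_entire f ->
  forall l, differentiable (fun l : R[i] => f (z + l *: v)) l.
Proof.
move=> df l; apply: (@differentiable_comp _ _ _ _ (fun l : R[i] => z + l *: v)); last exact: df.
by apply: differentiableD; [exact: differentiable_cst | apply: differentiableZl; exact: ex_diff].
Qed.

(** Restrict to the complex line from [z0] to [z]: [g] is non-zero near [z0] by continuity, so [f]
    vanishes there, and the one-variable principle carries this to [z]. *)
Lemma is_entire_mul_eq0 n (f g : 'rV[R[i]]_n -> R[i]) :
  is_entire f -> is_entire g -> (forall z, g z != 0 -> f z = 0) ->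
  not_identically_zero g -> forall z, f z = 0.
Proof.
move=> df dg fg [z0 gz0] z.
have -> : z = z0 + (1 : R[i]) *: (z - z0) by rewrite scale1r subrKC.
apply: (@identity_principle (fun l : R[i] => f (z0 + l *: (z - z0))) 0).
  exact: is_entire_line.
have := differentiable_continuous (is_entire_line z0 (z - z0) dg 0).
move=> /cvgr_neq0 /=; rewrite scale0r addr0 => /(_ gz0).
by apply: filterS => l /fg.
Qed.

End IdentityTheorem.

(** * Logarithms of entire functions without zeros *)

Section EntireLogarithm.
Variable R : realType.

Lemma near_eq_differentiable (K : numFieldType) (V W : normedModType K)
  (f g : V -> W) x :
  (\near x, f x = g x) -> differentiable f x -> differentiable g x.
Proof.
move=> fg df; have [cdf _] := (diff_locallyP x f).1 df.
have gE : g \o shift x = cst (g x) + 'd f x +o_ 0 id.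
  apply/eqaddoP => e e0.
  have /eqaddoP/(_ e e0) := diff_locally df.
  have fg0 : \forall h \near 0, f (h + x) = g (h + x).
    by move: fg; rewrite (near_shift 0 x); apply: filterS => y /=; rewrite subr0 /shift /=.
  apply: filterS2 fg0 => h; rewrite /= !fctE /= => fgh.
  by rewrite /shift /= fgh (nbhs_singleton fg).
by apply/diff_locallyP; rewrite (diff_unique cdf gE).
Qed.

Lemma clogE (z : R[i]) : clog z = (ln (cmod z))%:C
  + 'i%C * (atan (complex.Im z / complex.Re z))%:C.
Proof. by rewrite [LHS]complexE. Qed.

Lemma continuous_clog (z : R[i]) : 0 < complex.Re z -> {for z, continuous (@clog R)}.
Proof.
move=> z0; have m0 : 0 < cmod z by rewrite (lt_le_trans _ (cmod_Re _)) // gtr0_norm.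
have -> : @clog R = (fun z => (ln (cmod z))%:C
  + 'i%C * (atan (complex.Im z / complex.Re z))%:C) by apply/funext => y; exact: clogE.
have c1 : {for z, continuous (fun z : R[i] => ln (cmod z))}.
  by apply: (@continuous_comp _ _ _ (@cmod R) (@ln R)); [exact: continuous_cmod | exact: continuous_ln].
have c2 : {for z, continuous (fun z : R[i] => complex.Im z / complex.Re z)}.
  apply: (@continuousM _ _ (@complex.Im R)); first exact: continuous_Im.
  by apply: (@continuousV _ _ (@complex.Re R)); [rewrite gt_eqF | exact: continuous_Re].
have c3 : {for z, continuous (fun z : R[i] => atan (complex.Im z / complex.Re z))}.
  by apply: (@continuous_comp _ _ _ (fun z : R[i] => complex.Im z / complex.Re z)) => //; exact: continuous_atan.
have rc (f : R[i] -> R) : {for z, continuous f} -> {for z, continuous (fun z => (f z)%:C)}.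
  by move=> cf; apply: (@continuous_comp _ _ _ f) => //; exact: continuous_real_complex.
apply: (@continuousD _ _ _ (fun z => (ln (cmod z))%:C)); first exact: rc.
apply: (@continuousM _ _ (fun=> 'i%C)); first exact: cst_continuous.
exact: rc.
Qed.

Lemma clog1 : clog (1 : R[i]) = 0.
Proof. by rewrite clogE cmod1 ln1 /= mul0r atan0 mulr0 addr0. Qed.

(** Inverts the tangent estimate of [cexp]: with [k = clog (1 + h)] the error is at most
    [q * cmod k], and [q <= 1 / 2] yields [cmod k <= 2 * cmod h]. *)
Lemma differentiable_clog1 : differentiable (@clog R) (1 : R[i]).
Proof.
apply/differentiable_complexP; exists 1 => e e0; pose q := Num.min (e / 2) (1 / 2).
have q0 : 0 < q by rewrite lt_min; apply/andP; split; lra.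
have [q1 q2] : q <= e / 2 /\ q <= 1 / 2 by split; rewrite ge_min lexx ?orbT.
have [d d0 hd] := cexp_tangent q0.
have Re1 : 0 < complex.Re (1 : R[i]) by [].
have := continuous_clog Re1 => /cvgrPdist_lt /(_ d%:C).
rewrite ltcR => /(_ d0) /near_complexP[d' d'0 hd'].
have [r r0 hr] : exists2 r : R, 0 < r & r <= d' /\ r <= 1.
  exists (Num.min d' 1); first by rewrite lt_min d'0 ltr01.
  by split; rewrite ge_min lexx ?orbT.
exists r => // h hh; rewrite clog1 subr0 mul1r.
have Reh : 0 < complex.Re (1 + h).
  have := cmod_Re h; rewrite ler_norml => /andP[h1 _].
  have -> : complex.Re (1 + h) = 1 + complex.Re h by case: (h).
  by case: hr; lra.
have /= := hd' (1 + h); rewrite addrC addKr => /(_ (lt_le_trans hh hr.1)).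
rewrite clog1 sub0r normrN cmodE ltcR => /hd; rewrite clogK //.
set k := clog _; have -> : 1 + h - 1 - k = - (k - h) by ring.
rewrite cmodN => hk.
have k2 : cmod k <= 2 * cmod h.
  have := cmodD (k - h) h; rewrite subrK => hk2.
  have : q * cmod k <= 1 / 2 * cmod k by rewrite ler_wpM2r ?cmod_ge0.
  by lra.
apply: le_trans hk _.
have : q * cmod k <= e / 2 * (2 * cmod h) by apply: ler_pM; rewrite ?cmod_ge0 // ltW.
by have -> : e / 2 * (2 * cmod h) = e * cmod h by field.
Qed.

Lemma cexp_pi : cexp (0 +i* pi) = -1 :> R[i].
Proof.
rewrite /cexp /= expR0 cospi sinpi mul1r.
by apply/eqP; rewrite eq_complex /= oppr0 !eqxx.
Qed.

Lemma cexp_pihalf : cexp (0 +i* (pi / 2)) = 'i%C :> R[i].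
Proof. by rewrite /cexp /= expR0 cos_pihalf sin_pihalf mul1r. Qed.

(** The left half-plane reduces to the right one by the factor -1, the imaginary axis to the real
    one by the factor ['i]. *)
Lemma cexp_surj (z : R[i]) : z != 0 -> exists w, cexp w = z.
Proof.
have re_case (y : R[i]) : complex.Re y != 0 -> exists w, cexp w = y.
  rewrite neq_lt => /orP[y0|y0]; last by exists (clog y); rewrite clogK.
  exists (clog (- y) + (0 +i* pi)); rewrite cexpD cexp_pi clogK.
    by rewrite mulrN1 opprK.
  by move: y0; case: (y) => a b /=; rewrite oppr_gt0.
move=> z0; have [re0|] := eqVneq (complex.Re z) 0; last exact: re_case.
have zE : z = 'i%C * (complex.Im z)%:C by rewrite {1}[z]complexE re0 add0r.
have [w hw] : exists w, cexp w = (complex.Im z)%:C.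
  apply: re_case => /=; apply: contra z0 => /eqP im0.
  by rewrite zE im0 mulr0.
by exists ((0 +i* (pi / 2)) + w); rewrite cexpD cexp_pihalf hw -zE.
Qed.

(** If the imaginary part left [[-1, 1]], it would take the value 1 or -1 on the way; but there
    [cexp_eq1_small] gives [d t = 0]. *)
Lemma cexp_eq1_path (d : R -> R[i]) :
  (forall t, t \in `[0, 1] -> {for t, continuous d}) ->
  (forall t, t \in `[0, 1] -> cexp (d t) = 1) -> d 0 = 0 -> d 1 = 0.
Proof.
move=> cd ed d0.
have i1 : (1 : R) \in `[(0 : R), 1] by rewrite in_itv /= ler01 lexx.
have [/cexp_eq1_small -> //|big] := lerP `|complex.Im (d 1)| 1; first exact: ed.
have cI : {within `[(0 : R), 1], continuous (fun t => complex.Im (d t))}.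
  apply: continuous_in_subspaceT => t; rewrite inE => ht.
  by apply: continuous_comp; [exact: cd | exact: continuous_Im].
have im v : `|v| = 1 -> ~ (exists2 t, t \in `[(0 : R), 1] & complex.Im (d t) = v).
  move=> v1 [t ht tv]; have dt0 : d t = 0.
    by apply: cexp_eq1_small; [exact: ed | rewrite tv v1].
  by move: v1; rewrite -tv dt0 /= normr0 => /eqP; rewrite eq_sym oner_eq0.
move: big; rewrite lter_normr => /orP[big|big].
  case: (im 1); first by rewrite normr1.
  apply: (IVT ler01 cI); rewrite d0 /=.
  by rewrite ge_min le_max ler01 /= (ltW big) orbT.
case: (im (-1)); first by rewrite normrN1.
apply: (IVT ler01 cI); rewrite d0 /= ge_min le_max.
by apply/andP; split; apply/orP; [right | left]; lra.
Qed.

(** * Continuous lifting of [v] through [cexp] along rays from 0 *)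

Section Lift.
Variables (n : nat) (v : 'rV[R[i]]_n -> R[i]).
Hypotheses (cv : continuous v) (v0 : forall z, v z != 0).

(* Index [m] stands for a subdivision into [m.+1] pieces. *)
Definition fine_subdivision m z := forall s t : R, s \in `[0, 1] -> t \in `[0, 1] ->
  `|s - t| <= m.+1%:R^-1 ->
  cmod (v (s%:C *: z) - v (t%:C *: z)) < cmod (v (t%:C *: z)).

Definition sample m z (k : nat) := v ((k%:R / m.+1%:R : R)%:C *: z).

Definition log_lift m z : R[i] :=
  \sum_(k < m.+1) clog (sample m z k.+1 / sample m z k).

Lemma sample_itv m (k : nat) : (k <= m.+1)%N -> (k%:R / m.+1%:R : R) \in `[0, 1].
Proof.
move=> km; rewrite in_itv /= divr_ge0 //= ler_pdivrMr ?ltr0n // mul1r.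
by rewrite ler_nat.
Qed.

Lemma sample_ratio_Re m z k : fine_subdivision m z -> (k < m.+1)%N ->
  0 < complex.Re (sample m z k.+1 / sample m z k).
Proof.
move=> fz km; have a0 : sample m z k != 0 by exact: v0.
have := fz _ _ (@sample_itv m k.+1 km) (@sample_itv m k (ltnW km)).
rewrite -mulrBl -natrB // subSnn mul1r ger0_norm ?invr_ge0 // => /(_ (lexx _)).
rewrite -/(sample m z k) -/(sample m z k.+1).
set a := sample m z k in a0 *; set b := sample m z k.+1 => hab.
have : cmod (b / a - 1) < 1.
  rewrite -(ltr_pM2r (x := cmod a)) ?cmod_gt0 // -cmodM mul1r.
  by rewrite mulrBl mulfVK // mul1r.
move=> /(le_lt_trans (cmod_Re _)); rewrite ltr_norml => /andP[h _].
by move: h; case: (b / a) => x y /=; lra.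
Qed.

Lemma cexp_log_lift m z : fine_subdivision m z -> cexp (log_lift m z) = v z / v 0.
Proof.
move=> fz.
have part j : (j <= m.+1)%N -> cexp (\sum_(k < j) clog (sample m z k.+1 / sample m z k))
   = sample m z j / sample m z 0.
  elim: j => [_|j IH jm]; first by rewrite big_ord0 cexp0 divff // v0.
  rewrite big_ord_recr /= cexpD IH ?(ltnW jm) // clogK; last exact: sample_ratio_Re.
  have a0 : sample m z j != 0 by exact: v0.
  by rewrite mulrC mulrA mulfVK.
rewrite /log_lift part // /sample divff ?pnatr_eq0 // mul0r.
by rewrite scale1r scale0r.
Qed.

Lemma continuous_log_lift m z : fine_subdivision m z -> {for z, continuous (log_lift m)}.
Proof.
move=> fz.
have csamp k : continuous (fun z => sample m z k).
  move=> y; have cs : {for y, continuous (fun z : 'rV[R[i]]_n => (k%:R / m.+1%:R : R)%:C *: z)}.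
    exact: scaler_continuous.
  exact: (continuous_comp cs (@cv _)).
have ext (f g : 'rV[R[i]]_n -> R[i]) : f =1 g ->
    {for z, continuous f} -> {for z, continuous g} by move=> /funext ->.
have part j : (j <= m.+1)%N -> {for z, continuous
    (fun z => \sum_(k < j) clog (sample m z k.+1 / sample m z k))}.
  elim: j => [_|j IH jm].
    by apply: (ext (fun=> 0)) => [y|]; [rewrite big_ord0 | exact: cst_continuous].
  apply: ext => [y|]; first by rewrite big_ord_recr /=; reflexivity.
  apply: (@continuousD _ _ _ (fun z => \sum_(k < j) clog (sample m z k.+1 / sample m z k))).
    exact: IH (ltnW jm).
  apply: (@continuous_comp _ _ _ (fun z => sample m z j.+1 / sample m z j) (@clog R)).
    apply: (@continuousM _ _ (fun z => sample m z j.+1)); first exact: csamp.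
    by apply: (@continuousV _ _ (fun z => sample m z j)); [exact: v0 | exact: csamp].
  by apply: continuous_clog; exact: sample_ratio_Re.
exact: part.
Qed.

Lemma fine_subdivision_scale m z (r : R) : r \in `[0, 1] ->
  fine_subdivision m z -> fine_subdivision m (r%:C *: z).
Proof.
rewrite in_itv => /andP[r0 r1] fz s t; rewrite !in_itv => /andP[s0 s1] /andP[t0 t1] st.
have i01 (x : R) : 0 <= x -> x <= 1 -> x * r \in `[0, 1].
  by move=> x0 x1; rewrite in_itv /= mulr_ge0 // mulr_ile1.
rewrite !scalerA -!rmorphM /=; apply: fz; try exact: i01.
rewrite -mulrBl normrM (ger0_norm r0); apply: le_trans st.
by rewrite ler_piMr.
Qed.

Lemma continuous_ray (z : 'rV[R[i]]_n) : continuous (fun t : R => t%:C *: z).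
Proof.
move=> t; apply: (@continuous_comp _ _ _ (real_complex R) (fun l : R[i] => l *: z)).
  exact: continuous_real_complex.
exact: scalel_continuous.
Qed.

Lemma log_lift0 m : log_lift m 0 = 0.
Proof.
rewrite /log_lift big1 // => k _.
by rewrite /sample !scaler0 divff // clog1.
Qed.

(** Along the ray the difference of the two lifts is continuous, starts at 0 and has exponential
    1. *)
Lemma log_lift_indep m m' z : fine_subdivision m z -> fine_subdivision m' z ->
  log_lift m z = log_lift m' z.
Proof.
move=> fz fz'; apply/eqP; rewrite -subr_eq0; apply/eqP.
pose d t := log_lift m (t%:C *: z) - log_lift m' (t%:C *: z).
have -> : log_lift m z - log_lift m' z = d 1 by rewrite /d scale1r.
apply: cexp_eq1_path.
- move=> t t01.
  have cl k : fine_subdivision k z -> {for t, continuous (fun t : R => log_lift k (t%:C *: z))}.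
    move=> fk; have ck := continuous_log_lift (fine_subdivision_scale t01 fk).
    exact: (continuous_comp (@continuous_ray z t) ck).
  exact: (continuousB (cl _ fz) (cl _ fz')).
- move=> t t01; rewrite /d cexpD cexpN !cexp_log_lift ?divff //; try exact: fine_subdivision_scale.
  by rewrite mulf_neq0 // invr_neq0.
- by rewrite /d scale0r !log_lift0 subrr.
Qed.

(** Continuity gives the inequality near each parameter, for large [m] and [z] near [z0];
    compactness of [[0, 1]] makes the choice uniform. *)
Lemma near_fine_subdivision (z0 : 'rV[R[i]]_n) : exists m, \forall z \near z0, fine_subdivision m z.
Proof.
have /compact_near_coveringP cover := @segment_compact R 0 1.
pose P (mz : nat * 'rV[R[i]]_n) (t : R) := forall s : R, `|s - t| <= mz.1.+1%:R^-1 ->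
  cmod (v (s%:C *: mz.2) - v (t%:C *: mz.2)) < cmod (v (t%:C *: mz.2)).
have [|[A B] /= [[N _ NA] Bz0] hAB] :=
    cover (nat * 'rV[R[i]]_n)%type (filter_prod \oo (nbhs z0)) P _ _.
  move=> t0 _; pose phi (p : R * 'rV[R[i]]_n) := v (p.1%:C *: p.2).
  have cphi : {for (t0, z0), continuous phi}.
    apply: (@continuous_comp _ _ _ (fun p : R * 'rV[R[i]]_n => p.1%:C *: p.2)); last exact: cv.
    apply: (@continuousZ _ _ _ (fun p : R * 'rV[R[i]]_n => p.1%:C)).
      apply: (@continuous_comp _ _ _ (@fst R 'rV[R[i]]_n)); first exact: cvg_fst.
      exact: continuous_real_complex.
    exact: cvg_snd.
  pose c := v (t0%:C *: z0); have c0 : 0 < cmod c by rewrite cmod_gt0; exact: v0.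
  (* Two values within a third of [cmod c] from [c] differ by less than two thirds of it, while each
     has modulus above two thirds. *)
  have c3 : 0 < cmod c / 3 by lra.
  have /cvgrPdist_lt /(_ (cmod c / 3)%:C) := cphi.
  rewrite ltcR => /(_ c3) [[U W] /= [Ut Wz] hUW].
  have {}hUW t z : U t -> W z -> cmod (c - v (t%:C *: z)) < cmod c / 3.
    by move=> Ux Wx; have := hUW (t, z) (conj Ux Wx); rewrite /= cmodE ltcR.
  have /nbhs_ballP[d /= d0 dU] := Ut.
  have d20 : 0 < d / 2 by lra.
  exists (ball t0 (d / 2), [set m | m.+1%:R^-1 < d / 2] `*` W) => /=.
    split; first exact: nbhsx_ballx.
    exists ([set m | m.+1%:R^-1 < d / 2], W) => //=; split => //.
    exact: near_infty_natSinv_lt (PosNum d20).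
  move=> [t [m z]] /= [tb [/= md Wx]] s /= st.
  have Ux : U t by apply: dU; apply: le_ball tb; lra.
  have Us : U s.
    apply: dU; have {}tb : `|t0 - t| < d / 2 := tb.
    have -> : ball t0 d s = (`|t0 - s| < d) by [].
    have := ler_normD (t0 - t) (t - s).
    have {}md : m.+1%:R^-1 < d / 2 := md.
    have {}st : `|s - t| <= m.+1%:R^-1 := st.
    rewrite subrKA (distrC t) => h; apply: le_lt_trans h _.
    rewrite [d]splitr; apply: ltrD => //; exact: le_lt_trans st md.
  have h1 := hUW _ _ Ux Wx; have h2 := hUW _ _ Us Wx.
  have k1 := cmodD (v (s%:C *: z) - c) (c - v (t%:C *: z)).
  have k2 := cmodD (c - v (t%:C *: z)) (v (t%:C *: z)).
  rewrite subrKA (cmodB _ c) in k1; rewrite subrK in k2.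
  by clear - h1 h2 k1 k2; lra.
exists N; apply: filterS Bz0 => z Bz s t _ t01.
by apply: (hAB (N, z)) => //; split => //; exact: NA (leqnn N).
Qed.

Lemma entire_log : is_entire v -> exists G : entire R n, forall z, cexp (G z) = v z.
Proof.
move=> dv; have [c0 hc0] := cexp_surj (v0 0).
have fineE z : exists m, fine_subdivision m z.
  by have [m hm] := near_fine_subdivision z; exists m; exact: nbhs_singleton hm.
have [mesh hmesh] := boolp.choice fineE.
(* The mesh is chosen point by point, with no regularity; by independence [G] agrees near each point
   with a lift of fixed mesh. *)
pose G z := log_lift (mesh z) z + c0.
have GE z : cexp (G z) = v z by rewrite cexpD cexp_log_lift // hc0 mulfVK.
have cG (z0 : 'rV[R[i]]_n) : {for z0, continuous G}.
  have [m hm] := near_fine_subdivision z0.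
  have cl : {for z0, continuous (fun z => log_lift m z + c0)}.
    apply: (@continuousD _ _ _ (log_lift m) (fun=> c0)); last exact: cst_continuous.
    by apply: continuous_log_lift; exact: nbhs_singleton hm.
  have G0 : G z0 = log_lift m z0 + c0.
    by congr (_ + _); apply: log_lift_indep => //; exact: nbhs_singleton hm.
  have Gnear : \forall z \near z0, log_lift m z + c0 = G z.
    by apply: filterS hm => z fz; congr (_ + _); exact: log_lift_indep.
  rewrite /prop_for /continuous_at G0; apply: cvg_trans cl.
  by apply: (@near_eq_cvg _ _ (nbhs z0) (nbhs_filter z0)).
have dG : is_entire G.
  (* [H] equals [G] near [z0]: continuity keeps the imaginary part of [G z - G z0] within 1, where
     [clog] inverts [cexp]. *)
  move=> z0; pose H z := G z0 + clog (v z / v z0).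
  have dH : differentiable H z0.
    apply: differentiableD; first exact: differentiable_cst.
    apply: (@differentiable_comp _ _ _ _ (fun z => v z / v z0)).
      by apply: differentiableM; [exact: dv | exact: differentiable_cst].
    by rewrite divff //; exact: differentiable_clog1.
  apply: near_eq_differentiable dH.
  have /cvgrPdist_lt /(_ 1 ltr01) := cG z0.
  apply: filterS => z; rewrite cmodE ltcR => /ltW hz.
  rewrite /H -!GE -cexpN -cexpD cexpK ?subrKC //.
  by apply: le_trans (cmod_Im _) _; rewrite cmodB.
by exists (Entire dG).
Qed.

End Lift.

Lemma cexp_const n (g : 'rV[R[i]]_n -> R[i]) (c : R[i]) :
  continuous g -> (forall z, cexp (g z) = c) -> is_const g.
Proof.
move=> cg hg; exists (g 0) => z.
have := @cexp_eq1_path (fun t => g (t%:C *: z) - g 0).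
rewrite scale1r => h; apply/eqP; rewrite -subr_eq0; apply/eqP; apply: h.
- move=> t _; apply: (@continuousD _ _ _ (fun t : R => g (t%:C *: z)) (fun=> - g 0)).
    exact: (continuous_comp (@continuous_ray n z t) (@cg _)).
  exact: cst_continuous.
- by move=> t _; rewrite cexpD cexpN !hg -(hg 0) divff // cexp_neq0.
- by rewrite scale0r subrr.
Qed.

End EntireLogarithm.

(** * The representation as a linear system over a field *)

Section LinearSystem.
Variables (K : fieldType) (i k a1 a2 a3 a4 a5 a6 eta E E' s t u : K).
Hypotheses (hi : i ^+ 2 = -1) (hk : k ^+ 2 = 1) (two0 : (2 : K) != 0).
Let xi := a1 * a4 - a2 * a3.
Hypothesis xi0 : xi != 0.

Let sE := s = (2 * i * xi)^-1 * (- (k * a2 - i * a4) * E + eta * (k * a2 + i * a4) * E')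
  + xi^-1 * ((a2 * a6 - a4 * a5) * u).
Let tE := t = (2 * i * xi)^-1 * ((k * a1 - i * a3) * E + - (eta * (k * a1 + i * a3)) * E')
  + xi^-1 * ((a3 * a5 - a1 * a6) * u).
Let A := a1 * s + a2 * t + a5 * u.
Let B := a3 * s + a4 * t + a6 * u.

(** Both sides determine [A] and [B] as half the sum and half the difference over [i * k]; Cramer's
    rule with determinant [xi] passes between [A], [B] and [s], [t]. *)
Lemma linear_system : sE /\ tE <-> A + i * k * B = E /\ A - i * k * B = eta * E'.
Proof.
have i0 : i != 0.
  by apply/eqP => i0; move/eqP: hi; rewrite i0 expr0n eq_sym oppr_eq0 oner_eq0.
have k0 : k != 0.
  by apply/eqP => k0; move/eqP: hk; rewrite k0 expr0n eq_sym oner_eq0.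
have iV : i^-1 = - i by apply: (mulfI i0); rewrite divff // mulrN -expr2 hi opprK.
split=> [[hs ht] | [h1 h2]].
  have hA : A = (E + eta * E') / 2.
    rewrite /A hs ht; move: xi0; rewrite /xi => h; field; by rewrite h i0 two0.
  have hB : B = k * (E - eta * E') / (2 * i).
    rewrite /B hs ht; move: xi0; rewrite /xi => h; field; by rewrite h i0 two0.
  rewrite hA hB; split.
    by transitivity ((E + eta * E') / 2 + k ^+ 2 * (E - eta * E') / 2); [|rewrite hk]; field; rewrite ?i0 ?two0.
  by transitivity ((E + eta * E') / 2 - k ^+ 2 * (E - eta * E') / 2); [|rewrite hk]; field; rewrite ?i0 ?two0.
have h := xi0.
have kk : k * k = 1 by rewrite -expr2.
have ii : i * i = -1 by rewrite -expr2.
have hB : k * (i * i) * k * B = k * i * (E - eta * E') / 2 by rewrite -h1 -h2; field.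
have {}hB : B = - (k * i * (E - eta * E') / 2).
  by rewrite -hB ii; transitivity (k * k * B); [rewrite kk mul1r | ring].
have hA : A = (E + eta * E') / 2 by rewrite -h1 -h2; field.
have i2 : (2 * i * xi)^-1 = - i / 2 / xi by rewrite !invfM iV; ring.
rewrite /sE /tE !i2.
have sxi : xi * s = a4 * A - a2 * B + (a2 * a6 - a4 * a5) * u by rewrite /A /B /xi; ring.
have txi : xi * t = a1 * B - a3 * A + (a3 * a5 - a1 * a6) * u by rewrite /A /B /xi; ring.
(* [field] does not know that [i ^+ 2 = -1]; inserting [- (i * i)] in one term makes the identity
   hold formally in [i]. *)
have e4 (x : K) : x = - (i * i) * x by rewrite ii opprK mul1r.
split; apply: (mulfI h); [rewrite sxi | rewrite txi]; rewrite hA hB.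
  by rewrite [a4 * _]e4; move: h; generalize xi => x h; field; rewrite h two0.
by rewrite [a3 * _]e4; move: h; generalize xi => x h; field; rewrite h two0.
Qed.

End LinearSystem.

(** * Closure properties of entire functions *)

Section EntireAlgebra.
Variables (R : realType) (n : nat).
Implicit Types f g : 'rV[R[i]]_n -> R[i].

Lemma is_entireD f g : is_entire f -> is_entire g -> is_entire (fun z => f z + g z).
Proof. by move=> df dg z; exact: (differentiableD (df z) (dg z)). Qed.

Lemma is_entireN f : is_entire f -> is_entire (fun z => - f z).
Proof. by move=> df z; exact: (differentiableN (df z)). Qed.

Lemma is_entireB f g : is_entire f -> is_entire g -> is_entire (fun z => f z - g z).
Proof. by move=> df dg; apply: is_entireD => //; exact: is_entireN. Qed.

Lemma is_entireM f g : is_entire f -> is_entire g -> is_entire (fun z => f z * g z).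
Proof. by move=> df dg z; exact: (differentiableM (df z) (dg z)). Qed.

Lemma is_entire_sqr f : is_entire f -> is_entire (fun z => f z ^+ 2).
Proof. by move=> df; exact: is_entireM. Qed.

Lemma is_entire_cexp f : is_entire f -> is_entire (fun z => cexp (f z)).
Proof.
by move=> df z; exact: (differentiable_comp (df z) (@differentiable_cexp R (f z))).
Qed.

Lemma is_const_of_cexp f (c : R[i]) : is_entire f ->
  (forall z, cexp ('i%C * f z) = c) -> is_const f.
Proof.
move=> df hf; have dif : is_entire (fun z => 'i%C * f z).
  by apply: is_entireM => // z; exact: differentiable_cst.
have [d hd] := cexp_const (fun z => differentiable_continuous (dif z)) hf.
exists (- 'i%C * d) => z.
by rewrite -(hd z) mulrA mulNr -expr2 sqr_i opprK mul1r.
Qed.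

End EntireAlgebra.

(** * Existence, converse and uniqueness for the representation *)

Unset Implicit Arguments.

Theorem lemma2p1 (R : realType) (n : nat)
  (s t u : entire R n -> entire R n)
  (hst : s <> t) (hsu : s <> u) (htu : t <> u)
  (f eta eta1 eta2 eta3 eta4 eta5 eta6 : entire R n)
  (heta : entire_irreducible eta) :
  let xi0 := fun z : 'rV[R[i]]_n => eta1 z * eta4 z - eta2 z * eta3 z in
  let xi1 := fun z : 'rV[R[i]]_n => eta2 z * eta6 z - eta4 z * eta5 z in
  let xi2 := fun z : 'rV[R[i]]_n => eta3 z * eta5 z - eta1 z * eta6 z in
  let tau1 := fun (k : R[i]) (z : 'rV[R[i]]_n) => k * eta1 z - 'i%C * eta3 z in
  let tau2 := fun (k : R[i]) (z : 'rV[R[i]]_n) => k * eta1 z + 'i%C * eta3 z in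
  let zeta1 := fun (k : R[i]) (z : 'rV[R[i]]_n) => k * eta2 z - 'i%C * eta4 z in
  let zeta2 := fun (k : R[i]) (z : 'rV[R[i]]_n) => k * eta2 z + 'i%C * eta4 z in
  (* Identity of meromorphic functions with common denominator xi0: pointwise
     equality wherever xi0 does not vanish. *)
  let star := fun (k : R[i]) (g : entire R n) =>
    forall z : 'rV[R[i]]_n, xi0 z != 0 ->
      s f z = (2 * 'i%C * xi0 z)^-1 *
                (- zeta1 k z * cexp ('i%C * g z)
                 + eta z * zeta2 k z * cexp (- 'i%C * g z))
              + (xi0 z)^-1 * (xi1 z * u f z)
      /\
      t f z = (2 * 'i%C * xi0 z)^-1 *
                (tau1 k z * cexp ('i%C * g z)
                 + - (eta z * tau2 k z) * cexp (- 'i%C * g z))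
              + (xi0 z)^-1 * (xi2 z * u f z) in
  not_identically_zero xi0 ->
  ((forall z : 'rV[R[i]]_n,
      (eta1 z * s f z + eta2 z * t f z + eta5 z * u f z) ^+ 2
      + (eta3 z * s f z + eta4 z * t f z + eta6 z * u f z) ^+ 2 = eta z)
   <->
   exists (k : R[i]) (g : entire R n), (k = 1 \/ k = -1) /\ star k g)
  /\
  (forall (k kstar : R[i]) (g gstar : entire R n),
     (k = 1 \/ k = -1) -> star k g ->
     (kstar = 1 \/ kstar = -1) -> star kstar gstar ->
     is_const (fun z => g z + gstar z) \/ is_const (fun z => g z - gstar z)).
Proof.
move=> xi0 xi1 xi2 tau1 tau2 zeta1 zeta2 star xi_n0.
pose A z := eta1 z * s f z + eta2 z * t f z + eta5 z * u f z.
pose B z := eta3 z * s f z + eta4 z * t f z + eta6 z * u f z.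
have two0 : (2 : R[i]) != 0 by rewrite pnatr_eq0.
have sqr_sign (k : R[i]) : k = 1 \/ k = -1 -> k ^+ 2 = 1.
  by case=> ->; rewrite ?sqrrN expr1n.
have starP k (g : entire R n) : k = 1 \/ k = -1 -> star k g <->
    forall z, xi0 z != 0 -> A z + 'i%C * k * B z = cexp ('i%C * g z) /\
      A z - 'i%C * k * B z = eta z * (cexp ('i%C * g z))^-1.
  move=> /sqr_sign hk; have L z hz := @linear_system R[i] 'i%C k (eta1 z) (eta2 z)
    (eta3 z) (eta4 z) (eta5 z) (eta6 z) (eta z) (cexp ('i%C * g z))
    (cexp ('i%C * g z))^-1 (s f z) (t f z) (u f z) (sqr_i R) hk two0 hz.
  have cN z : cexp (- 'i%C * g z) = (cexp ('i%C * g z))^-1 by rewrite mulNr cexpN.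
  split=> h z hz; have := h z hz; rewrite ?cN => h'; [exact: (L z hz).1 | exact: (L z hz).2].
have eA : is_entire A by do !apply: is_entireD; apply: is_entireM; exact: entire_funP.
have eB : is_entire B by do !apply: is_entireD; apply: is_entireM; exact: entire_funP.
have eC (c : R[i]) : is_entire (fun _ : 'rV[R[i]]_n => c) by move=> z; exact: differentiable_cst.
have exi : is_entire xi0.
  by apply: is_entireB; apply: is_entireM; exact: entire_funP.
have eAB (k : R[i]) : is_entire (fun z => A z + 'i%C * k * B z).
  exact: (is_entireD eA (is_entireM (eC ('i%C * k)) eB)).
have eE (g : entire R n) : is_entire (fun z => cexp ('i%C * g z)).
  exact: (is_entire_cexp (is_entireM (eC 'i%C) (entire_funP g))).
(* [star] speaks only where [xi0] does not vanish; this extends its entire consequences to all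
   points. *)
have density (h1 h2 : 'rV[R[i]]_n -> R[i]) : is_entire h1 -> is_entire h2 ->
    (forall z, xi0 z != 0 -> h1 z = h2 z) -> forall z, h1 z = h2 z.
  move=> d1 d2 h12 z; apply/eqP; rewrite -subr_eq0; apply/eqP.
  apply: (is_entire_mul_eq0 (f := fun z => h1 z - h2 z) _ exi _ xi_n0).
    exact: is_entireB.
  by move=> y /h12 ->; rewrite subrr.
have factor k z : k ^+ 2 = 1 ->
    A z ^+ 2 + B z ^+ 2 = (A z + 'i%C * k * B z) * (A z - 'i%C * k * B z).
  move=> hk; transitivity (A z ^+ 2 - 'i%C ^+ 2 * k ^+ 2 * B z ^+ 2); last by ring.
  by rewrite sqr_i hk mulr1 mulN1r opprK.
split; first split.
- move=> hAB.
  (* The sign [k] selects a zero-free factor. If [G] is its logarithm, then [g = - 'i * G], and the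
     other factor is [eta] divided by it. *)
  suff [k [hk kz]] : exists k : R[i], (k = 1 \/ k = -1) /\
      forall z, A z + 'i%C * k * B z != 0.
    have [G hG] := entire_log (fun z => differentiable_continuous (eAB k z)) kz (eAB k).
    have eg : is_entire (fun z => - 'i%C * G z) by exact: (is_entireM (eC _) (entire_funP G)).
    exists k, (Entire eg); split=> //; apply/(starP _ _ hk) => z _ /=.
    have -> : 'i%C * (- 'i%C * G z) = G z.
      by rewrite mulrA mulrN -expr2 sqr_i opprK mul1r.
    by rewrite hG; split=> //; rewrite -hAB -/(A z) -/(B z) (factor k) ?sqr_sign //
      [RHS]mulrAC divff ?mul1r.
  have prod z : eta z = (A z + 'i%C * 1 * B z) * (A z + 'i%C * -1 * B z).
    rewrite -hAB -/(A z) -/(B z) (factor 1) ?expr1n //.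
    by rewrite mulrN mulNr.
  (* For a non-zero constant [eta] neither factor has zeros and [k = 1] will do; otherwise
     irreducibility decides the sign. *)
  case: heta => [[[c hc] [z0 z0n]] | [_ _ irr]].
    exists 1; split; first by left.
    move=> z; have : eta z != 0 by rewrite hc -(hc z0).
    by rewrite prod mulf_eq0 negb_or => /andP[].
  have [h|h] := irr (Entire (eAB 1)) (Entire (eAB (-1))) prod.
    by exists 1; split; [left | exact: h].
  by exists (-1); split; [right | exact: h].
- move=> [k [g [hk /(starP _ _ hk) hs]]].
  apply: density; [| exact: entire_funP|].
    by apply: is_entireD; apply: is_entire_sqr.
  move=> z /hs [h1 h2]; rewrite -/(A z) -/(B z) (factor k) ?sqr_sign // h1 h2.
  by rewrite mulrCA divff ?mulr1 // cexp_neq0.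
move=> k k' g g' hk /(starP _ _ hk) hg hk' /(starP _ _ hk') hg'.
have i0 : 'i%C != 0 :> R[i] by rewrite eq_complex /= oner_eq0 andbF.
(* Equal signs make the two exponentials equal, so [g - g'] is constant. Opposite signs make one the
   cofactor of the other, so [e^(i(g + g'))] is [eta]. *)
have [kk|kk] : k' = k \/ k' = - k.
  case: hk hk' => -> [] ->; rewrite ?opprK; by [left | right].
- right; apply: (is_const_of_cexp (c := 1)).
    by apply: is_entireB; exact: entire_funP.
  move=> z; rewrite mulrBr cexpD cexpN.
  have -> : cexp ('i%C * g z) = cexp ('i%C * g' z).
    apply: (density (fun z => cexp ('i%C * g z)) (fun z => cexp ('i%C * g' z))) => // y hy.
    by rewrite -(hg y hy).1 -(hg' y hy).1 kk.
  by rewrite divff ?cexp_neq0.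
left; have eta_exp z : cexp ('i%C * (g z + g' z)) = eta z.
  apply: (density (fun z => cexp ('i%C * (g z + g' z))) eta) => [|  |y hy].
  - exact: (is_entire_cexp (is_entireM (eC _) (is_entireD (entire_funP g) (entire_funP g')))).
  - exact: entire_funP.
  rewrite mulrDr cexpD -(hg' y hy).1 kk mulrN mulNr (hg y hy).2.
  by rewrite mulrCA divff ?mulr1 // cexp_neq0.
(* Being an exponential, [eta] is a unit; irreducibility then leaves only the constant case. *)
case: heta => [[[c hc] _] | [_ nunit _]].
  apply: (is_const_of_cexp (c := c)); first by apply: is_entireD; exact: entire_funP.
  by move=> z; rewrite eta_exp.
case: nunit.
have ei : is_entire (fun z => cexp (- ('i%C * (g z + g' z)))).
  apply/is_entire_cexp/is_entireN.
  exact: (is_entireM (eC _) (is_entireD (entire_funP g) (entire_funP g'))).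
by exists (Entire ei) => z /=; rewrite cexpN eta_exp divff // -eta_exp cexp_neq0.
Qed.
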